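(* Let $\nu\in\mathbb{R}$, fix a choice of square root $\sqrt\nu$ and set $\nu^{3/2}=\nu\sqrt\nu$. The equation $$u_{tx}=(1+\nu\partial_x^2)\sin(u)$$ for a scalar-valued function $u(x,t)$ is the compatibility condition of the Lax pair $$\psi_x+i\lambda\sigma_3\psi=W_1\psi,\qquad \psi_t+i\left(\nu\lambda-\frac{1}{4\lambda}\right)\sigma_3\psi=W_2\psi,$$ where $\psi(x,t,\lambda)$ is a $2\times2$-matrix valued function, $\lambda$ is a complex spectral parameter, and $$W_1=u_x\left(\frac i2\sigma_1+\lambda\sqrt\nu\,\sigma_2\right),$$ $$W_2=\frac{i}{4\lambda}\left[\sin(u)\sigma_2+(\cos(u)-1)\sigma_3\right]+\left[\frac{i\nu}{2}\cos(u)u_x-\frac{\sqrt\nu}{2}\sin(u)\right]\sigma_1+\lambda\left[\nu^{3/2}\cos(u)u_x\sigma_2-i\nu(\cos(u)-1)\sigma_3\right].$$ That is, with $L=-i\lambda\sigma_3+W_1$ and $M=-i\left(\nu\lambda-\frac1{4\lambda}\right)\sigma_3+W_2$, a smooth function $u$ satisfies $u_{tx}=(1+\nu\partial_x^2)\sin(u)$ if and only if $L_t-M_x+[L,M]=0$ for all $\lambda\in\mathbb{C}\setminus\{0\}$.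
   Context: $\sigma_1=\begin{pmatrix}0&1\\1&0\end{pmatrix}$, $\sigma_2=\begin{pmatrix}0&-i\\i&0\end{pmatrix}$, $\sigma_3=\begin{pmatrix}1&0\\0&-1\end{pmatrix}$. $[L,M]=LM-ML$. Subscripts $x,t$ denote partial derivatives. *)

(* Defs.v *)
From Stdlib Require Import Reals Lra.
From Coquelicot Require Import Coquelicot.

Local Open Scope C_scope.

Definition Cexp (z : C) : C :=
  (exp (Re z) * cos (Im z), exp (Re z) * sin (Im z))%R.

Definition Csin (z : C) : C := (Cexp (Ci * z) - Cexp (- (Ci * z))) / (2 * Ci).

Definition Ccos (z : C) : C := (Cexp (Ci * z) + Cexp (- (Ci * z))) / 2.

Lemma Csin_RtoC (a : R) : Csin (RtoC a) = RtoC (sin a).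
Proof.
unfold Csin, Cexp; simpl.
replace (0 * a - 1 * 0)%R with 0%R by ring.
replace (0 * 0 + 1 * a)%R with a by ring.
rewrite Ropp_0, exp_0, cos_neg, sin_neg.
unfold RtoC, Cdiv, Cinv, Cmult, Cminus, Cplus, Copp, Ci; simpl.
f_equal; field; lra.
Qed.

Lemma Ccos_RtoC (a : R) : Ccos (RtoC a) = RtoC (cos a).
Proof.
unfold Ccos, Cexp; simpl.
replace (0 * a - 1 * 0)%R with 0%R by ring.
replace (0 * 0 + 1 * a)%R with a by ring.
rewrite Ropp_0, exp_0, cos_neg, sin_neg.
unfold RtoC, Cdiv, Cinv, Cmult, Cminus, Cplus, Copp; simpl.
f_equal; field; lra.
Qed.

(** Functions of two real variables [(x, t)], in this order, with complex
    values: partial derivatives act on real and imaginary parts. *)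

Definition pdx (f : R -> R -> C) (x t : R) : C :=
  (Derive (fun y : R => Re (f y t)) x, Derive (fun y : R => Im (f y t)) x).

Definition pdt (f : R -> R -> C) (x t : R) : C :=
  (Derive (fun s : R => Re (f x s)) t, Derive (fun s : R => Im (f x s)) t).

(** [ex_diff_n f n x t] for all [x] and [t] says that [f] is of class
    [C^n] on the plane: all iterated partial derivatives up to order [n]
    exist and are jointly continuous. *)
Definition smooth (u : R -> R -> C) : Prop :=
  forall (n : nat) (x t : R),
    ex_diff_n (fun y s : R => Re (u y s)) n x t /\
    ex_diff_n (fun y s : R => Im (u y s)) n x t.

(** Addition, subtraction and product of matrices below are those of
    the ring structure carried by [@matrix C 2 2]. *)

Definition mat2 : Type := @matrix C 2 2.

Declare Scope mat2_scope.
Delimit Scope mat2_scope with M.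
Bind Scope mat2_scope with mat2.

Definition madd (A B : mat2) : mat2 := plus A B.
Definition msub (A B : mat2) : mat2 := minus A B.
Definition mmul (A B : mat2) : mat2 := mult A B.
Definition mzero : mat2 := zero.
Definition mscale (c : C) (A : mat2) : mat2 :=
  mk_matrix 2 2 (fun i j : nat => c * coeff_mat (RtoC 0) A i j).

Notation "A + B" := (madd A B) : mat2_scope.
Notation "A - B" := (msub A B) : mat2_scope.
Notation "A * B" := (mmul A B) : mat2_scope.
Notation "c *: A" := (mscale c%C A%M)
  (at level 40, left associativity) : mat2_scope.

Definition commutator (A B : mat2) : mat2 := (A * B - B * A)%M.

Definition mpdx (A : R -> R -> mat2) (x t : R) : mat2 :=
  mk_matrix 2 2 (fun i j : nat =>
    pdx (fun y s : R => coeff_mat (RtoC 0) (A y s) i j) x t).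

Definition mpdt (A : R -> R -> mat2) (x t : R) : mat2 :=
  mk_matrix 2 2 (fun i j : nat =>
    pdt (fun y s : R => coeff_mat (RtoC 0) (A y s) i j) x t).

Definition mk2 (a b c d : C) : mat2 :=
  mk_matrix 2 2 (fun i j : nat =>
    match i, j with
    | O, O => a
    | O, _ => b
    | _, O => c
    | _, _ => d
    end).

Definition sigma1 : mat2 := mk2 0 1
                                1 0.
Definition sigma2 : mat2 := mk2 0  (- Ci)
                                Ci 0.
Definition sigma3 : mat2 := mk2 1 0
                                0 (- (1)).

(** The argument [r] is the chosen square root of [nu], so
    that [nu * r] is [nu] to the power 3/2. *)

Definition W1 (r : C) (u : R -> R -> C) (lam : C) (x t : R) : mat2 :=
  (pdx u x t *: ((Ci / 2) *: sigma1 + (lam * r) *: sigma2))%M.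

Definition W2 (nu : R) (r : C) (u : R -> R -> C) (lam : C) (x t : R) : mat2 :=
  ((Ci / (4 * lam)) *:
      (Csin (u x t) *: sigma2 + (Ccos (u x t) - 1) *: sigma3)
   + (Ci * nu / 2 * Ccos (u x t) * pdx u x t - r / 2 * Csin (u x t)) *: sigma1
   + lam *:
      ((nu * r * Ccos (u x t) * pdx u x t) *: sigma2
       - (Ci * nu * (Ccos (u x t) - 1)) *: sigma3))%M.

Definition LaxL (r : C) (u : R -> R -> C) (lam : C) (x t : R) : mat2 :=
  ((- (Ci * lam)) *: sigma3 + W1 r u lam x t)%M.

Definition LaxM (nu : R) (r : C) (u : R -> R -> C) (lam : C) (x t : R)
    : mat2 :=
  ((- (Ci * (nu * lam - 1 / (4 * lam)))) *: sigma3 + W2 nu r u lam x t)%M.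

(* Main.v *)
(** In the basis of Pauli matrices the curvature [L_t - M_x + [L, M]] equals
    [E (i/2 sigma1 + lambda r sigma2)], where [E] is the difference of the two
    sides of the equation: the [sigma3]-component vanishes because
    [r ^ 2 = nu].  The [sigma1]-component at a single [lambda], for example 1,
    thus recovers the equation.  Smoothness gives [u_tx = u_xt]. *)

Require Import Defs.
From Stdlib Require Import Reals Lra Lia FunctionalExtensionality.
From Coquelicot Require Import Coquelicot.

Local Open Scope C_scope.

(** * Differentiation of complex-valued functions of a real variable *)

Definition is_derive_RC (f : R -> C) (x : R) (l : C) : Prop :=
  is_derive (fun y => Re (f y)) x (Re l) /\
  is_derive (fun y => Im (f y)) x (Im l).

Lemma is_derive_RC_eq f x l l' :
  is_derive_RC f x l -> l = l' -> is_derive_RC f x l'.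
Proof. now intros H <-. Qed.

Lemma is_derive_RC_const c x : is_derive_RC (fun _ => c) x 0.
Proof. split; apply (is_derive_const (V := R_NormedModule)). Qed.

Lemma is_derive_RC_plus f g x a b :
  is_derive_RC f x a -> is_derive_RC g x b ->
  is_derive_RC (fun y => f y + g y) x (a + b).
Proof.
intros [Hf1 Hf2] [Hg1 Hg2]; split.
- exact (is_derive_plus _ _ _ _ _ Hf1 Hg1).
- exact (is_derive_plus _ _ _ _ _ Hf2 Hg2).
Qed.

Lemma is_derive_RC_opp f x a :
  is_derive_RC f x a -> is_derive_RC (fun y => - f y) x (- a).
Proof.
intros [H1 H2]; split.
- exact (is_derive_opp _ _ _ H1).
- exact (is_derive_opp _ _ _ H2).
Qed.

Lemma is_derive_RC_minus f g x a b :
  is_derive_RC f x a -> is_derive_RC g x b ->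
  is_derive_RC (fun y => f y - g y) x (a - b).
Proof.
intros Hf Hg; apply is_derive_RC_plus; [exact Hf|].
now apply is_derive_RC_opp.
Qed.

Lemma is_derive_Rmult (f g : R -> R) x a b :
  is_derive f x a -> is_derive g x b ->
  is_derive (fun y => f y * g y)%R x (a * g x + f x * b)%R.
Proof. intros Hf Hg; exact (is_derive_mult f g x a b Hf Hg Rmult_comm). Qed.

Lemma is_derive_RC_mult f g x a b :
  is_derive_RC f x a -> is_derive_RC g x b ->
  is_derive_RC (fun y => f y * g y) x (a * g x + f x * b).
Proof.
intros [Hf1 Hf2] [Hg1 Hg2]; split.
- evar_last.
  + exact (is_derive_minus _ _ _ _ _ (is_derive_Rmult _ _ _ _ _ Hf1 Hg1)
             (is_derive_Rmult _ _ _ _ _ Hf2 Hg2)).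
  + unfold minus, plus, opp, Re, Im; simpl; ring.
- evar_last.
  + exact (is_derive_plus _ _ _ _ _ (is_derive_Rmult _ _ _ _ _ Hf1 Hg2)
             (is_derive_Rmult _ _ _ _ _ Hf2 Hg1)).
  + unfold plus, Re, Im; simpl; ring.
Qed.

Lemma is_derive_RC_scal c f x a :
  is_derive_RC f x a -> is_derive_RC (fun y => c * f y) x (c * a).
Proof.
intros Hf; eapply is_derive_RC_eq.
- apply is_derive_RC_mult; [apply is_derive_RC_const|exact Hf].
- cbv beta; ring.
Qed.

(** With f = p + iq, this is the real chain rule applied to e^p cos q and e^p sin q, whose
    derivatives are the real and imaginary parts of e^f f'. *)
Lemma is_derive_RC_exp f x a :
  is_derive_RC f x a ->
  is_derive_RC (fun y => Cexp (f y)) x (Cexp (f x) * a).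
Proof.
intros [H1 H2].
assert (He := is_derive_comp exp _ x _ _ (is_derive_exp _) H1).
assert (Hc := is_derive_comp cos _ x _ _ (is_derive_cos _) H2).
assert (Hs := is_derive_comp sin _ x _ _ (is_derive_sin _) H2).
split; evar_last.
- exact (is_derive_Rmult _ _ _ _ _ He Hc).
- unfold scal; simpl; unfold mult, Re, Im; simpl; ring.
- exact (is_derive_Rmult _ _ _ _ _ He Hs).
- unfold scal; simpl; unfold mult, Re, Im; simpl; ring.
Qed.

Lemma Ci_sqr : Ci * Ci = - (1).
Proof. apply injective_projections; simpl; ring. Qed.

Lemma Ci_neq_0 : Ci <> 0.
Proof. intros H; injection H; lra. Qed.

Lemma Cinv_2Ci : / (2 * Ci) = - (Ci / 2).
Proof. apply injective_projections; simpl; field. Qed.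

Lemma is_derive_RC_sin f x a :
  is_derive_RC f x a -> is_derive_RC (fun y => Csin (f y)) x (Ccos (f x) * a).
Proof.
intros Hf; unfold Csin, Cdiv.
assert (Hi := is_derive_RC_scal Ci f x a Hf).
eapply is_derive_RC_eq.
- apply is_derive_RC_mult; [|apply is_derive_RC_const].
  apply is_derive_RC_minus; apply is_derive_RC_exp; [exact Hi|].
  apply is_derive_RC_opp; exact Hi.
- unfold Ccos; cbv beta; field; exact Ci_neq_0.
Qed.

Lemma is_derive_RC_cos f x a :
  is_derive_RC f x a ->
  is_derive_RC (fun y => Ccos (f y)) x (- (Csin (f x) * a)).
Proof.
intros Hf; unfold Ccos, Cdiv.
assert (Hi := is_derive_RC_scal Ci f x a Hf).
eapply is_derive_RC_eq.
- apply is_derive_RC_mult; [|apply is_derive_RC_const].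
  apply is_derive_RC_plus; apply is_derive_RC_exp; [exact Hi|].
  apply is_derive_RC_opp; exact Hi.
(* Differentiation puts i in the numerator, while [Csin] has it in the denominator; writing 1/(2i)
   as -i/2 makes both sides linear in i, so [field] closes the goal without i^2 = -1. *)
- unfold Csin, Cdiv; rewrite Cinv_2Ci; cbv beta.
  set (e1 := Cexp _); set (e2 := Cexp _).
  field.
Qed.

(** * Partial derivatives of smooth functions and their symmetry *)

Lemma pdx_unique (f : R -> R -> C) x t l :
  is_derive_RC (fun y => f y t) x l -> pdx f x t = l.
Proof.
intros [H1 H2]; apply injective_projections; simpl.
- exact (is_derive_unique _ _ _ H1).
- exact (is_derive_unique _ _ _ H2).
Qed.

Lemma pdt_unique (f : R -> R -> C) x t l :
  is_derive_RC (fun s => f x s) t l -> pdt f x t = l.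
Proof.
intros [H1 H2]; apply injective_projections; simpl.
- exact (is_derive_unique _ _ _ H1).
- exact (is_derive_unique _ _ _ H2).
Qed.

Lemma smooth_is_derive_x u x t :
  smooth u -> is_derive_RC (fun y => u y t) x (pdx u x t).
Proof.
intros hu; destruct (hu 1%nat x t) as [[_ [H1 _]] [_ [H2 _]]].
split; apply Derive_correct; assumption.
Qed.

Lemma smooth_is_derive_t u x t :
  smooth u -> is_derive_RC (fun s => u x s) t (pdt u x t).
Proof.
intros hu; destruct (hu 1%nat x t) as [[_ [_ [H1 _]]] [_ [_ [H2 _]]]].
split; apply Derive_correct; assumption.
Qed.

Lemma smooth_pdx u : smooth u -> smooth (pdx u).
Proof.
intros hu n x t.
destruct (hu (S n) x t) as [[_ [_ [_ [H1 _]]]] [_ [_ [_ [H2 _]]]]].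
split; assumption.
Qed.

Lemma ex_diff_n_Schwarz (f : R -> R -> R) :
  (forall n x y, ex_diff_n f n x y) ->
  forall x y,
    Derive (fun z => Derive (fun s => f z s) y) x =
    Derive (fun s => Derive (fun z => f z s) x) y.
Proof.
intros hf x y; apply Schwarz.
(* The derivatives exist on the whole plane, so the radius 1 is an arbitrary choice. *)
- exists (mkposreal 1 Rlt_0_1); intros a b _ _.
  destruct (hf 2%nat a b) as [_ [Hx [Hy [[_ [_ [Hxy _]]] [_ [Hyx _]]]]]].
  repeat split; assumption.
- destruct (hf 2%nat x y) as [_ [_ [_ [_ [_ [_ [_ [[H _] _]]]]]]]]; exact H.
- destruct (hf 2%nat x y) as [_ [_ [_ [[_ [_ [_ [_ [H _]]]]] _]]]]; exact H.
Qed.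

Lemma pdx_pdt_comm u x t : smooth u -> pdx (pdt u) x t = pdt (pdx u) x t.
Proof.
intros hu; unfold pdx, pdt; simpl; f_equal.
- apply (ex_diff_n_Schwarz (fun y s => Re (u y s))); intros; apply hu.
- apply (ex_diff_n_Schwarz (fun y s => Im (u y s))); intros; apply hu.
Qed.

(** * Traceless matrices in Pauli coordinates *)

Lemma mk2_add a b c d a' b' c' d' :
  (mk2 a b c d + mk2 a' b' c' d')%M = mk2 (a + a') (b + b') (c + c') (d + d').
Proof. reflexivity. Qed.

Lemma mk2_sub a b c d a' b' c' d' :
  (mk2 a b c d - mk2 a' b' c' d')%M = mk2 (a - a') (b - b') (c - c') (d - d').
Proof. reflexivity. Qed.

Lemma mk2_scale z a b c d :
  (z *: mk2 a b c d)%M = mk2 (z * a) (z * b) (z * c) (z * d).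
Proof. reflexivity. Qed.

Lemma mk2_mul a b c d a' b' c' d' :
  (mk2 a b c d * mk2 a' b' c' d')%M =
  mk2 (a * a' + b * c') (a * b' + b * d') (c * a' + d * c') (c * b' + d * d').
Proof.
unfold mmul, mk2, mult; simpl; unfold Mmult.
apply mk_matrix_ext; intros [|[|i]] [|[|j]] Hi Hj; try (exfalso; lia);
  simpl; now rewrite sum_Sn, sum_O.
Qed.

(** The matrix a sigma1 + b sigma2 + c sigma3. Both Lax matrices are traceless, and traceless
    matrices are stable under sums, scaling, commutators and differentiation, so three coordinates
    carry the whole computation. *)
Definition pauli (a b c : C) : mat2 := mk2 c (a - Ci * b) (a + Ci * b) (- c).

Lemma pauli_add a b c a' b' c' :
  (pauli a b c + pauli a' b' c')%M = pauli (a + a') (b + b') (c + c').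
Proof. unfold pauli; rewrite mk2_add; f_equal; ring. Qed.

Lemma pauli_sub a b c a' b' c' :
  (pauli a b c - pauli a' b' c')%M = pauli (a - a') (b - b') (c - c').
Proof. unfold pauli; rewrite mk2_sub; f_equal; ring. Qed.

Lemma pauli_scale z a b c : (z *: pauli a b c)%M = pauli (z * a) (z * b) (z * c).
Proof. unfold pauli; rewrite mk2_scale; f_equal; ring. Qed.

(** Since [sigma1, sigma2] = 2i sigma3 and cyclically, the commutator is 2i times the cross product
    of the coordinate vectors. *)
Lemma commutator_pauli a b c a' b' c' :
  commutator (pauli a b c) (pauli a' b' c') =
  pauli (2 * Ci * (b * c' - c * b')) (2 * Ci * (c * a' - a * c'))
    (2 * Ci * (a * b' - b * a')).
Proof.
unfold commutator, pauli; rewrite !mk2_mul, mk2_sub.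
f_equal; ring [Ci_sqr].
Qed.

(** Linear independence of the Pauli matrices: c is a diagonal entry, and a and b come from the sum
    and difference of the off-diagonal entries a - ib and a + ib. *)
Lemma pauli_eq_0 a b c : pauli a b c = mzero <-> a = 0 /\ b = 0 /\ c = 0.
Proof.
split.
- intros H.
  assert (H00 : c = 0) by exact (f_equal (fun A => coeff_mat (RtoC 0) A 0 0) H).
  assert (H01 : a - Ci * b = 0)
    by exact (f_equal (fun A => coeff_mat (RtoC 0) A 0 1) H).
  assert (H10 : a + Ci * b = 0)
    by exact (f_equal (fun A => coeff_mat (RtoC 0) A 1 0) H).
  repeat split; [| |exact H00].
  + replace a with (((a - Ci * b) + (a + Ci * b)) / 2) by field.
    rewrite H01, H10; field.
  + replace b with (((a + Ci * b) - (a - Ci * b)) / (2 * Ci))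
      by (field; exact Ci_neq_0).
    rewrite H01, H10; field; exact Ci_neq_0.
- intros [-> [-> ->]].
  replace mzero with (mk2 0 0 0 0) by reflexivity.
  unfold pauli; f_equal; ring.
Qed.

Lemma sigma1_pauli : sigma1 = pauli 1 0 0.
Proof. unfold sigma1, pauli; f_equal; ring. Qed.

Lemma sigma2_pauli : sigma2 = pauli 0 1 0.
Proof. unfold sigma2, pauli; f_equal; ring. Qed.

Lemma sigma3_pauli : sigma3 = pauli 0 0 1.
Proof. unfold sigma3, pauli; f_equal; ring. Qed.

(** The Pauli matrices are constant, so differentiation acts on the coordinates alone. *)
Lemma mpdx_pauli A a b c x t a' b' c' :
  (forall y s, A y s = pauli (a y s) (b y s) (c y s)) ->
  is_derive_RC (fun y => a y t) x a' ->
  is_derive_RC (fun y => b y t) x b' ->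
  is_derive_RC (fun y => c y t) x c' ->
  mpdx A x t = pauli a' b' c'.
Proof.
intros HA Ha Hb Hc.
replace A with (fun y s => pauli (a y s) (b y s) (c y s))
  by (do 2 (apply functional_extensionality; intro); now rewrite HA).
unfold mpdx, pauli, mk2; apply mk_matrix_ext.
intros [|[|i]] [|[|j]] Hi Hj; try (exfalso; lia); apply pdx_unique.
- exact Hc.
- exact (is_derive_RC_minus _ _ _ _ _ Ha (is_derive_RC_scal Ci _ _ _ Hb)).
- exact (is_derive_RC_plus _ _ _ _ _ Ha (is_derive_RC_scal Ci _ _ _ Hb)).
- exact (is_derive_RC_opp _ _ _ Hc).
Qed.

Lemma mpdt_pauli A a b c x t a' b' c' :
  (forall y s, A y s = pauli (a y s) (b y s) (c y s)) ->
  is_derive_RC (fun s => a x s) t a' ->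
  is_derive_RC (fun s => b x s) t b' ->
  is_derive_RC (fun s => c x s) t c' ->
  mpdt A x t = pauli a' b' c'.
Proof.
intros HA Ha Hb Hc.
replace A with (fun y s => pauli (a y s) (b y s) (c y s))
  by (do 2 (apply functional_extensionality; intro); now rewrite HA).
unfold mpdt, pauli, mk2; apply mk_matrix_ext.
intros [|[|i]] [|[|j]] Hi Hj; try (exfalso; lia); apply pdt_unique.
- exact Hc.
- exact (is_derive_RC_minus _ _ _ _ _ Ha (is_derive_RC_scal Ci _ _ _ Hb)).
- exact (is_derive_RC_plus _ _ _ _ _ Ha (is_derive_RC_scal Ci _ _ _ Hb)).
- exact (is_derive_RC_opp _ _ _ Hc).
Qed.

(** * The Lax pair and its curvature in Pauli coordinates *)

Lemma LaxL_pauli r u (lam : C) x t :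
  LaxL r u lam x t =
  pauli (Ci / 2 * pdx u x t) (lam * r * pdx u x t) (- (Ci * lam)).
Proof.
unfold LaxL, W1.
rewrite sigma1_pauli, sigma2_pauli, sigma3_pauli, ?pauli_scale, ?pauli_add,
  ?pauli_scale, ?pauli_add.
f_equal; field.
Qed.

(** The -1 in cos(u) - 1 cancels the free sigma3-term of M. The product cos(u) u_x is kept together
    because it is the x-derivative of sin(u). *)
Lemma LaxM_pauli (nu : R) r u (lam : C) x t :
  LaxM nu r u lam x t =
  pauli (Ci * nu / 2 * (Ccos (u x t) * pdx u x t) - r / 2 * Csin (u x t))
    (Ci / (4 * lam) * Csin (u x t) + lam * nu * r * (Ccos (u x t) * pdx u x t))
    ((Ci / (4 * lam) - Ci * nu * lam) * Ccos (u x t)).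
Proof.
unfold LaxM, W2.
rewrite sigma1_pauli, sigma2_pauli, sigma3_pauli.
repeat (rewrite pauli_scale || rewrite pauli_add || rewrite pauli_sub).
(* The scalar 1/(4 lambda) becomes an indeterminate, which leaves identities polynomial in [lam] and
   [k]. *)
unfold Cdiv; generalize (/ (4 * lam)); intros k.
f_equal; field.
Qed.

Lemma pdx_Csin u : smooth u ->
  pdx (fun y s => Csin (u y s)) = (fun x t => Ccos (u x t) * pdx u x t).
Proof.
intros hu; apply functional_extensionality; intros x.
apply functional_extensionality; intros t.
exact (pdx_unique _ x t _ (is_derive_RC_sin _ _ _ (smooth_is_derive_x u x t hu))).
Qed.

(** In the sigma1-component the commutator's lambda^2 terms cancel each other, and its term -(r/2)
    cos(u) u_x cancels against -M_x. In the sigma3-component what remains is i lambda (r^2 - nu)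
    sin(u) u_x. *)
Lemma curvature_pauli (nu : R) (r : C) u (lam : C) x t :
  r * r = RtoC nu -> smooth u -> lam <> 0 ->
  let E := pdx (pdt u) x t
    - (Csin (u x t) + nu * pdx (pdx (fun y s => Csin (u y s))) x t) in
  (mpdt (LaxL r u lam) x t - mpdx (LaxM nu r u lam) x t
   + commutator (LaxL r u lam x t) (LaxM nu r u lam x t))%M =
  pauli (Ci / 2 * E) (lam * r * E) 0.
Proof.
intros hr hu hlam E; subst E.
assert (Hux := smooth_is_derive_x u x t hu).
assert (Huxx := smooth_is_derive_x _ x t (smooth_pdx u hu)).
assert (Huxt := smooth_is_derive_t _ x t (smooth_pdx u hu)).
assert (Hs := is_derive_RC_sin _ _ _ Hux).
assert (Hc := is_derive_RC_cos _ _ _ Hux).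
assert (Hcu := is_derive_RC_mult _ _ _ _ _ Hc Huxx).
(* E is brought to the derivatives that the Lax matrices produce: L_t contains the t-derivative of
   u_x, and M_x the x-derivative of cos(u) u_x. *)
rewrite (pdx_pdt_comm u x t hu), (pdx_Csin u hu).
rewrite (pdx_unique (fun x t => Ccos (u x t) * pdx u x t) x t _ Hcu).
rewrite (mpdt_pauli _ _ _ _ x t _ _ _ (LaxL_pauli r u lam)
  (is_derive_RC_scal _ _ _ _ Huxt) (is_derive_RC_scal _ _ _ _ Huxt)
  (is_derive_RC_const _ _)).
rewrite (mpdx_pauli _ _ _ _ x t _ _ _ (LaxM_pauli nu r u lam)
  (is_derive_RC_minus _ _ _ _ _ (is_derive_RC_scal _ _ _ _ Hcu)
    (is_derive_RC_scal _ _ _ _ Hs))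
  (is_derive_RC_plus _ _ _ _ _ (is_derive_RC_scal _ _ _ _ Hs)
    (is_derive_RC_scal _ _ _ _ Hcu))
  (is_derive_RC_scal _ _ _ _ Hc)).
rewrite LaxL_pauli, LaxM_pauli, commutator_pauli, pauli_sub, pauli_add.
cbv beta.
(* Once nu is replaced by r^2, the only relation left to supply is i^2 = -1. *)
rewrite <- hr; f_equal; field [Ci_sqr]; exact hlam.
Qed.

Theorem mainTheorem3 (nu : R) (r : C) (hr : (r * r)%C = RtoC nu)
    (u : R -> R -> C) (hu : smooth u) :
  (forall x t : R,
     pdx (pdt u) x t =
       (Csin (u x t) + nu * pdx (pdx (fun y s : R => Csin (u y s))) x t)%C)
  <->
  (forall lam : C, lam <> RtoC 0 -> forall x t : R,
     (mpdt (LaxL r u lam) x t - mpdx (LaxM nu r u lam) x t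
      + commutator (LaxL r u lam x t) (LaxM nu r u lam x t))%M = mzero).
Proof.
split.
- intros H lam hlam x t.
  rewrite (curvature_pauli nu r u lam x t hr hu hlam), H.
  apply pauli_eq_0; repeat split; field.
- intros H x t.
  specialize (H 1 C1_nz x t).
  rewrite (curvature_pauli nu r u 1 x t hr hu C1_nz) in H.
  (* The sigma1-coordinate is kept because its factor i/2 is invertible, whereas the factor r of the
     sigma2-coordinate vanishes when nu = 0. *)
  apply pauli_eq_0 in H; destruct H as [H _].
  apply Ceq_minus.
  match type of H with _ * ?E = _ =>
    replace E with (2 / Ci * (Ci / 2 * E)) by (field; exact Ci_neq_0)
  end.
  rewrite H; ring.
Qed.
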